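(* Let $A$ be a unital $C^*$-algebra with unitary group $U(A)$. For any non-empty finite set $Q\subseteq A$ and any $\beta>0$, there exist a non-empty finite set $Q'\subseteq U(A)$ and $\beta'>0$ such that $V_H(Q',\beta')\subseteq V_H(Q,\beta)$ for every unital Hilbert bimodule $H$ over $A$. Consequently, for any $C^*$-subalgebra $B\subseteq A$ containing the identity of $A$, one can replace non-empty finite subsets of $A$ by non-empty finite subsets of $U(A)$ in the definitions of both property $(T)$ and strong property $(T)$ of the pair $(A,B)$ (that is, the resulting definitions are equivalent to the original ones).
   Context: A unital Hilbert bimodule over $A$ is a Hilbert space $H$ with commuting unital left and right actions of $A$ coming from a non-degenerate $*$-representation of $A\otimes_{\max}A^{\rm op}$, with $(a\otimes b^{\rm op})\xi=a\cdot\xi\cdot b$ ($A^{\rm op}$ is the opposite $C^*$-algebra). For such $H$, $H^B:=\{\xi\in H: b\cdot\xi=\xi\cdot b\text{ for all }b\in B\}$ and $P^B_H:H\to H^B$ is the orthogonal projection. For a non-empty finite $Q\subseteq A$ and $\beta>0$, $V_H(Q,\beta):=\{\xi\in H:\|\xi\|=1,\ \|x\cdot\xi-\xi\cdot x\|<\beta\text{ for all }x\in Q\}$. The pair $(A,B)$ has property $(T)$ if there exist a non-empty finite $F\subseteq A$ and $\epsilon>0$ such that for any unital Hilbert bimodule $H$ over $A$, $V_H(F,\epsilon)\neq\emptyset$ implies $H^B\neq\{0\}$. The pair $(A,B)$ has strong property $(T)$ if for any $\alpha>0$ there exist a non-empty finite $Q\subseteq A$ and $\beta>0$ such that for any unital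 Hilbert bimodule $H$ over $A$ and any $\xi\in V_H(Q,\beta)$, $\|\xi-P^B_H(\xi)\|<\alpha$. *)

(* Defs.v *)
From HB Require Import structures.
From mathcomp Require Import all_boot all_order all_algebra.
From mathcomp Require Import sesquilinear complex.
From mathcomp Require Import all_classical all_reals all_analysis.

Set Implicit Arguments.
Unset Strict Implicit.
Unset Printing Implicit Defensive.

Import Order.TTheory GRing.Theory Num.Theory.
Import numFieldNormedType.Exports.

Local Open Scope classical_set_scope.
Local Open Scope ring_scope.
Local Open Scope complex_scope.

(* As for the norm `|x| of a normed module over R[i], the values of cnorm lie in
   R[i]; cnorm_ge0 makes them real.  Real bounds are compared with norms through
   the embedding e%:C.  The norm is not taken from NormedModule because the
   hierarchy has no structure joining nzRingType and normedZmodType below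
   numDomainType. *)
HB.mixin Record isCStarAlgebra (R : realType) A & GRing.Algebra R[i] A := {
  cnorm : A -> R[i];
  star : A -> A;
  cnorm_ge0 : forall a : A, 0 <= cnorm a;
  cnorm0_eq0 : forall a : A, cnorm a = 0 -> a = 0;
  cnormD : forall a b : A, cnorm (a + b) <= cnorm a + cnorm b;
  cnormZ : forall (c : R[i]) (a : A), cnorm (c *: a) = `|c| * cnorm a;
  cnormM : forall a b : A, cnorm (a * b) <= cnorm a * cnorm b;
  cnorm_complete : forall u : nat -> A,
    (forall e : R, 0 < e -> exists N : nat, forall m n : nat,
       (N <= m)%N -> (N <= n)%N -> cnorm (u m - u n) < e%:C) ->
    exists l : A, forall e : R, 0 < e -> exists N : nat, forall n : nat,
      (N <= n)%N -> cnorm (u n - l) < e%:C;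
  starK : forall a : A, star (star a) = a;
  starD : forall a b : A, star (a + b) = star a + star b;
  starZ : forall (c : R[i]) (a : A), star (c *: a) = Num.conj c *: star a;
  starM : forall a b : A, star (a * b) = star b * star a;
  cnorm_starM : forall a : A, cnorm (star a * a) = cnorm a ^+ 2
}.

#[short(type="cstarAlgType")]
HB.structure Definition CStarAlgebra (R : realType) :=
  {A of isCStarAlgebra R A & GRing.Algebra R[i] A}.

(* A^c is MathComp's converse ring; with the linear structure, the norm and the
   involution of A it is the opposite C*-algebra of A. *)
Section Opposite.
Variables (R : realType) (A : cstarAlgType R).

HB.instance Definition _ := GRing.Lmodule.copy A^c A.

Let op_scalerAl (c : R[i]) (a b : A^c) : c *: (a * b) = (c *: a : A^c) * b.
Proof. exact: (scalerAr c (b : A) (a : A)). Qed.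

HB.instance Definition _ :=
  GRing.Lmodule_isLalgebra.Build R[i] A^c op_scalerAl.

Let op_scalerAr (c : R[i]) (a b : A^c) : c *: (a * b) = a * (c *: b : A^c).
Proof. exact: (scalerAl c (b : A) (a : A)). Qed.

HB.instance Definition _ :=
  GRing.Lalgebra_isAlgebra.Build R[i] A^c op_scalerAr.

Let op_cnorm (a : A^c) : R[i] := cnorm (a : A).
Let op_star (a : A^c) : A^c := star (a : A).

Let op_cnormM (a b : A^c) : op_cnorm (a * b) <= op_cnorm a * op_cnorm b.
Proof. by rewrite mulrC; exact: (cnormM (b : A) (a : A)). Qed.

Let op_starM (a b : A^c) : op_star (a * b) = op_star b * op_star a.
Proof. exact: (starM (b : A) (a : A)). Qed.

Lemma cnorm_star (a : A) : cnorm (star a) = cnorm a.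
Proof.
have le_star (b : A) : cnorm b <= cnorm (star b).
  have [b0|b_neq0] := eqVneq (cnorm b) 0; first by rewrite b0 cnorm_ge0.
  have b_gt0 : 0 < cnorm b by rewrite lt_neqAle eq_sym b_neq0 cnorm_ge0.
  by rewrite -(ler_pM2r b_gt0) -expr2 -cnorm_starM cnormM.
by apply/eqP; rewrite eq_le le_star andbT -{2}(starK a) le_star.
Qed.

Let op_cnorm_starM (a : A^c) : op_cnorm (op_star a * a) = op_cnorm a ^+ 2.
Proof.
have := cnorm_starM (star (a : A)).
by rewrite starK cnorm_star.
Qed.

HB.instance Definition _ := isCStarAlgebra.Build R A^c
  (@cnorm_ge0 R A) (@cnorm0_eq0 R A) (@cnormD R A) (@cnormZ R A) op_cnormM
  (@cnorm_complete R A) (@starK R A) (@starD R A) (@starZ R A) op_starM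
  op_cnorm_starM.

End Opposite.

HB.mixin Record isHilbert (R : realType) H & CompleteNormedModule R[i] H := {
  inner : {dot H for (@Num.conj R[i])};
  inner_norm : forall x : H, inner x x = `|x| ^+ 2
}.

#[short(type="hilbertType")]
HB.structure Definition Hilbert (R : realType) :=
  {H of isHilbert R H & CompleteNormedModule R[i] H}.

Section Definitions.
Variable R : realType.

Definition star_preserving (A D : cstarAlgType R) (f : A -> D) :=
  forall a, f (star a) = star (f a).

Definition commuting_ranges (A B D : cstarAlgType R) (f : A -> D) (g : B -> D) :=
  forall a b, f a * g b = g b * f a.

(* T is the maximal tensor product of the unital C*-algebras A and B, with
   elementary tensors a (x) b = iA a * iB b: it is universal for pairs of unital
   *-homomorphisms on A and B with commuting ranges. *)
Definition is_max_tensor (A B T : cstarAlgType R)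
    (iA : {lrmorphism A -> T}) (iB : {lrmorphism B -> T}) :=
  [/\ star_preserving iA, star_preserving iB, commuting_ranges iA iB
    & forall (D : cstarAlgType R) (f : {lrmorphism A -> D})
        (g : {lrmorphism B -> D}),
        star_preserving f -> star_preserving g -> commuting_ranges f g ->
        exists h : {lrmorphism T -> D},
          [/\ star_preserving h, h \o iA =1 f, h \o iB =1 g
            & forall k : {lrmorphism T -> D}, star_preserving k ->
                k \o iA =1 f -> k \o iB =1 g -> k =1 h]].

Record star_representation (T : cstarAlgType R) (H : hilbertType R)
    (pi : T -> H -> H) : Prop := {
  rep_linear : forall t, linear (pi t);
  rep_continuous : forall t, continuous (pi t);
  rep_linear_alg : forall (c : R[i]) s t xi,
    pi (c *: s + t) xi = c *: pi s xi + pi t xi;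
  rep_mul : forall s t xi, pi (s * t) xi = pi s (pi t xi);
  rep_star : forall t xi eta, inner (pi t xi) eta = inner xi (pi (star t) eta)
}.

Definition nondegenerate_rep (T : cstarAlgType R) (H : hilbertType R)
    (pi : T -> H -> H) :=
  closure [set eta : H | exists s : seq (T * H),
                           eta = \sum_(p <- s) pi p.1 p.2] = [set: H].

(* ract H xi a is the right action of a on xi. *)
Record hilbertBimodule (A : cstarAlgType R) := HilbertBimodule {
  bimod_space :> hilbertType R;
  lact : A -> bimod_space -> bimod_space;
  ract : bimod_space -> A -> bimod_space;
  lact1 : forall xi, lact 1 xi = xi;
  ract1 : forall xi, ract xi 1 = xi;
  lractC : forall a xi b, ract (lact a xi) b = lact a (ract xi b);
  bimod_tensor : exists (T : cstarAlgType R) (iA : {lrmorphism A -> T})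
      (iAop : {lrmorphism A^c -> T}) (pi : T -> bimod_space -> bimod_space),
    [/\ is_max_tensor iA iAop, star_representation pi, nondegenerate_rep pi
      & forall a b xi, pi (iA a * iAop b) xi = ract (lact a xi) b]
}.

Variable A : cstarAlgType R.
Implicit Types (H : hilbertBimodule A) (B Q U : set A).

Definition unitary_group : set A :=
  [set u | star u * u = 1 /\ u * star u = 1].

(* C*-subalgebras of A containing the identity of A *)
Definition unital_cstar_subalgebra B :=
  [/\ GRing.subalg_closed (mem B),
      forall a, B a -> B (star a)
    & forall a, (forall e : R, 0 < e ->
        exists2 b, B b & cnorm (a - b) < e%:C) -> B a].

Definition central_vectors H B : set H :=
  [set xi | forall b, B b -> lact b xi = ract xi b].

(* The vector of M whose difference with xi is orthogonal to M.  It exists and is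
   unique when M is a closed subspace; the default value of xget is then unused. *)
Definition orthogonal_projection (H : hilbertType R) (M : set H) (xi : H) : H :=
  xget 0 [set eta | M eta /\ forall zeta, M zeta -> inner (xi - eta) zeta = 0].

Definition almost_central H Q (beta : R) : set H :=
  [set xi | `|xi| = 1 /\ forall x, Q x -> `|lact x xi - ract xi x| < beta%:C].

Arguments almost_central : clear implicits.
Arguments central_vectors : clear implicits.

(* The finite test sets are taken inside U, so that the same formula covers
   subsets of A and subsets of the unitary group. *)
Definition property_T_within U B :=
  exists (F : set A) (eps : R),
    [/\ finite_set F, F !=set0, F `<=` U, 0 < eps
      & forall H, almost_central H F eps !=set0 ->
                  central_vectors H B <> [set 0]].

Definition strong_property_T_within U B :=
  forall alpha : R, 0 < alpha ->
  exists (Q : set A) (beta : R),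
    [/\ finite_set Q, Q !=set0, Q `<=` U, 0 < beta
      & forall H (xi : H), almost_central H Q beta xi ->
          `|xi - orthogonal_projection (central_vectors H B) xi| < alpha%:C].

Definition property_T := property_T_within setT.
Definition strong_property_T := strong_property_T_within setT.

End Definitions.

Arguments unitary_group {R} A.
Arguments central_vectors {R A} H B.
Arguments almost_central {R A} H Q beta.

(* Main.v *)
(** A self-adjoint h of norm at most 1/2 is the real part of the unitary
    h + i (1 - t), where t is the solution of t = (h^2 + t^2) / 2 of norm at most
    1/2; that is, 1 - t is a square root of 1 - h^2.  The map whose fixed point is
    t is a contraction of the ball of radius 1/2, and the same contraction
    estimate applied to t^* - t and to the commutator h t - t h shows that both
    vanish.  Hence every element of A is a linear combination of unitaries, and
    x.xi - xi.x is linear in x, so finitely many unitaries control all of Q. *)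

Require Import Defs.
From mathcomp Require Import all_boot all_order all_algebra.
From mathcomp Require Import complex lra.
From mathcomp Require Import all_classical all_reals all_analysis.

Local Open Scope classical_set_scope.
Local Open Scope ring_scope.

Import Order.TTheory GRing.Theory Num.Theory.
Local Open Scope complex_scope.

(** * Norm estimates, and small self-adjoint elements as real parts of unitaries *)

Section RealNorm.
Variables (R : realType) (A : cstarAlgType R).
Implicit Types (a b h t u x y z p q : A) (c : R[i]).

Definition rnorm a : R := complex.Re (cnorm a).

Lemma rnormE a : cnorm a = (rnorm a)%:C.
Proof. by rewrite RRe_real // ger0_real // cnorm_ge0. Qed.

Lemma rnorm_ge0 a : 0 <= rnorm a.
Proof. by rewrite -lecR -rnormE cnorm_ge0. Qed.

Lemma rnorm0_eq0 a : rnorm a = 0 -> a = 0.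
Proof. by move=> a0; apply: cnorm0_eq0; rewrite rnormE a0. Qed.

Lemma rnormD a b : rnorm (a + b) <= rnorm a + rnorm b.
Proof. by rewrite -lecR rmorphD /= -!rnormE cnormD. Qed.

Lemma rnormM a b : rnorm (a * b) <= rnorm a * rnorm b.
Proof. by rewrite -lecR rmorphM /= -!rnormE cnormM. Qed.

Lemma rnormZ (r : R) a : 0 <= r -> rnorm (r%:C *: a) = r * rnorm a.
Proof.
move=> r_ge0; apply: (@complexI R).
by rewrite rmorphM /= -!rnormE cnormZ ger0_norm // ler0c.
Qed.

Lemma rnorm0 : rnorm (0 : A) = 0.
Proof. by rewrite -(scale0r (0 : A)) (rnormZ 0) ?mul0r. Qed.

Lemma rnormN a : rnorm (- a) = rnorm a.
Proof. by rewrite /rnorm -scaleN1r cnormZ normrN1 mul1r. Qed.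

Lemma rnorm_distC a b : rnorm (a - b) = rnorm (b - a).
Proof. by rewrite -rnormN opprB. Qed.

Lemma rnorm_star a : rnorm (star a) = rnorm a.
Proof. by rewrite /rnorm cnorm_star. Qed.

Lemma real_complexV2 : (2^-1 : R)%:C = (2^-1 : R[i]).
Proof. by rewrite fmorphV rmorph_nat. Qed.

Lemma starN a : star (- a) = - star a.
Proof. by rewrite -scaleN1r starZ rmorphN1 scaleN1r. Qed.

Lemma starB a b : star (a - b) = star a - star b.
Proof. by rewrite starD starN. Qed.

Lemma star1 : star (1 : A) = 1.
Proof. by rewrite -[LHS]mulr1 -{2}[1]starK -starM mulr1 starK. Qed.

(** The contraction estimate: [z * p + q * z] has norm at most [(rnorm p + rnorm q) * rnorm z], and
    the two bounds add up to 1. *)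
Lemma rnorm_half_sandwich p q z : rnorm p <= 2^-1 -> rnorm q <= 2^-1 ->
  rnorm (2^-1 *: (z * p + q * z)) <= 2^-1 * rnorm z.
Proof.
move=> le_p le_q; rewrite -real_complexV2 rnormZ ?invr_ge0 //.
have := rnormD (z * p) (q * z); have := rnormM z p; have := rnormM q z.
have := rnorm_ge0 z; have := rnorm_ge0 p; have := rnorm_ge0 q; nra.
Qed.

Lemma half_sandwich_eq0 p q z : rnorm p <= 2^-1 -> rnorm q <= 2^-1 ->
  z = 2^-1 *: (z * p + q * z) -> z = 0.
Proof.
move=> le_p le_q fix_z; apply: rnorm0_eq0.
have := rnorm_half_sandwich p q z le_p le_q; rewrite -fix_z.
have := rnorm_ge0 z; lra.
Qed.

(** The factorisation of a difference of squares that survives noncommutativity; it produces the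
    expressions bounded above. *)
Lemma subr_sqr_sandwich x y : x * x - y * y = (x - y) * x + y * (x - y).
Proof. by rewrite mulrBl mulrBr addrA subrK. Qed.

(** Banach iteration of [f] from 0 inside the closed ball of radius 1/2. *)
Lemma half_sqr_fixpoint h : rnorm h <= 2^-1 ->
  exists2 t, rnorm t <= 2^-1 & t = 2^-1 *: (h * h + t * t).
Proof.
move=> le_h; pose f x := 2^-1 *: (h * h + x * x).
have f_ball x : rnorm x <= 2^-1 -> rnorm (f x) <= 2^-1.
  move=> le_x; rewrite /f -real_complexV2 rnormZ ?invr_ge0 //.
  have := rnormD (h * h) (x * x); have := rnormM h h; have := rnormM x x.
  have := rnorm_ge0 x; have := rnorm_ge0 h; nra.
have f_contr x y : rnorm x <= 2^-1 -> rnorm y <= 2^-1 ->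
    rnorm (f x - f y) <= 2^-1 * rnorm (x - y).
  move=> le_x le_y; rewrite /f -scalerBr opprD addrACA subrr add0r.
  by rewrite subr_sqr_sandwich; apply: rnorm_half_sandwich.
pose s n := iter n f 0.
have s_ball n : rnorm (s n) <= 2^-1.
  by elim: n => [|n IHn]; [rewrite rnorm0 invr_ge0 | exact: f_ball].
(* Each induction step strips one [f] from both iterates, so the bound is uniform in [k] and no
   geometric series has to be summed. *)
have s_dist n k : rnorm (s (n + k)%N - s n) <= 2^-1 ^+ n.
  elim: n => [|n IHn]; first by rewrite subr0 expr0; have := s_ball k; lra.
  rewrite exprS; apply: (le_trans (f_contr _ _ (s_ball _) (s_ball _))).
  by rewrite ler_pM2l ?invr_gt0.
have s_cauchy (e : R) : 0 < e -> exists N : nat, forall m n : nat,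
    (N <= m)%N -> (N <= n)%N -> cnorm (s m - s n) < e%:C.
  move=> e_gt0; have e2_gt0 : 0 < e / 2 by rewrite divr_gt0.
  have [N _ ltN] : \forall n \near \oo, `|0 - (2^-1 : R) ^+ n| < e / 2.
    by have /cvgrPdist_lt := @cvg_expr R 2^-1 ltac:(rewrite ger0_norm; lra); exact.
  have {}ltN : (2^-1 : R) ^+ N < e / 2.
    by have := ltN N (leqnn N); rewrite sub0r normrN ger0_norm // exprn_ge0 // invr_ge0.
  (* Both iterates lie within [2^-1 ^+ N < e / 2] of [s N]. *)
  exists N => m n /subnKC <- /subnKC <-; rewrite rnormE ltcR.
  have := rnormD (s (N + (m - N))%N - s N) (s N - s (N + (n - N))%N).
  rewrite addrA subrK (rnorm_distC (s N)).
  have := s_dist N (m - N)%N; have := s_dist N (n - N)%N; lra.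
have [t t_lim] := cnorm_complete s s_cauchy.
have le_t : rnorm t <= 2^-1.
  apply/ler_addgt0Pr => e e_gt0; have [N /(_ N (leqnn N))] := t_lim e e_gt0.
  rewrite rnormE ltcR rnorm_distC; have := rnormD (t - s N) (s N).
  by rewrite subrK; have := s_ball N; lra.
(* [t - f t] splits at [s N.+1 = f (s N)]: the first part is small by convergence, the second by
   contraction. *)
exists t => //; apply/eqP; rewrite -subr_eq0; apply/eqP/rnorm0_eq0.
apply/eqP; rewrite eq_le rnorm_ge0 andbT; apply/ler_addgt0Pr => e e_gt0.
have e2_gt0 : 0 < e / 2 by rewrite divr_gt0.
have [N s_near] := t_lim _ e2_gt0.
have := s_near _ (leqnn N); have := s_near _ (leqnSn N).
rewrite !rnormE !ltcR -/(f t).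
have := rnormD (t - s N.+1) (s N.+1 - f t).
rewrite addrA subrK (rnorm_distC t).
have := f_contr _ _ (s_ball N) le_t; rewrite -[f (s N)]/(s N.+1).
by have := rnorm_ge0 (s N - t); lra.
Qed.

(** Doubling the equation gives [h * h + t * t = t + t], which cancels the cross terms of the
    expanded square. *)
Lemma sqr_one_sub_half_sqr_fixpoint h t : t = 2^-1 *: (h * h + t * t) ->
  h * h + (1 - t) * (1 - t) = 1.
Proof.
move=> fix_t; have t2 : h * h + t * t = t + t.
  by rewrite [in RHS]fix_t -scalerDl -[2^-1]mul1r -splitr scale1r.
rewrite mulrBl mul1r mulrBr mulr1 opprB addrC -!addrA [- t + h * h]addrC.
by rewrite [t * t + _]addrA [t * t + _]addrC t2 addrK addNr addr0.
Qed.

Lemma selfadjoint_re_unitary h : star h = h -> rnorm h <= 2^-1 ->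
  exists2 u, unitary_group A u & h = 2^-1 *: (u + star u).
Proof.
move=> h_sa le_h; have [t le_t fix_t] := half_sqr_fixpoint _ le_h.
(* As [h] is self-adjoint, [star t] solves the same equation, so [z = star t - t] is half of
   [z * star t + t * z]. *)
have t_sa : star t = t.
  apply/eqP; rewrite -subr_eq0; apply/eqP.
  apply: (half_sandwich_eq0 (star t) t); rewrite ?rnorm_star //.
  rewrite -subr_sqr_sandwich {1}fix_t starZ starD !starM h_sa [in X in _ - X]fix_t.
  rewrite fmorphV rmorph_nat -scalerBr; congr (_ *: _).
  by rewrite opprD addrACA subrr add0r.
(* Here [z = h * t - t * h]; since [h] commutes with [h * h], substituting the equation leaves half
   of [z * t + t * z]. *)
have ht : h * t = t * h.
  apply/eqP; rewrite -subr_eq0; apply/eqP.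
  apply: (half_sandwich_eq0 t t) => //.
  rewrite {1 2}fix_t -scalerAr -scalerAl -scalerBr; congr (_ *: _).
  by rewrite mulrDr mulrDl !mulrA opprD addrACA subrr add0r mulrBl mulrBr !mulrA addrA subrK.
pose s := 1 - t; have s_sa : star s = s by rewrite starB star1 t_sa.
have hs : h * s = s * h by rewrite mulrBl mulrBr ht mul1r mulr1.
have hhss : h * h + s * s = 1 by exact: sqr_one_sub_half_sqr_fixpoint.
have su : star (h + 'i%R *: s) = h - 'i%R *: s.
  by rewrite starD starZ h_sa s_sa conjCi scaleNr.
exists (h + 'i%R *: s); last first.
  by rewrite su addrACA subrr addr0 scalerDr -scalerDl -[2^-1]mul1r -splitr scale1r.
have iss : ('i%R *: s) * ('i%R *: s) = - (s * s).
  by rewrite -scalerAl -scalerAr scalerA -expr2 sqrCi scaleN1r.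
have his : h * ('i%R *: s) = ('i%R *: s) * h by rewrite -scalerAr -scalerAl hs.
by split; rewrite su mulrDr !mulrDl ?mulrN ?mulNr iss his opprK addrA ?subrK ?addrK.
Qed.

End RealNorm.

(** * Bounding commutators with vectors by those of finitely many unitaries *)

Section UnitaryControl.
Variables (R : realType) (A : cstarAlgType R).
Implicit Types (x y u : A) (H : hilbertBimodule A).

Definition bimod_comm H x (xi : H) : H := lact x xi - ract xi x.

(** Both actions are read off the representation of the tensor product by putting 1 in the other
    factor, and so inherit its linearity in the algebra element. *)
Lemma bimod_comm_linear H c x y (xi : H) :
  bimod_comm H (c *: x + y) xi = c *: bimod_comm H x xi + bimod_comm H y xi.
Proof.
have [T [iA [iAop [pi [_ pi_rep _ piE]]]]] := bimod_tensor H.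
have lactE a : lact a xi = pi (iA a) xi.
  by rewrite -[LHS]ract1 -piE rmorph1 mulr1.
have ractE a : ract xi a = pi (iAop a) xi.
  by rewrite -[xi in LHS]lact1 -piE rmorph1 mul1r.
rewrite /bimod_comm !lactE !ractE !linearP !(rep_linear_alg pi_rep).
by rewrite scalerBr opprD addrACA.
Qed.

Lemma bimod_commD H x y (xi : H) :
  bimod_comm H (x + y) xi = bimod_comm H x xi + bimod_comm H y xi.
Proof. by rewrite -[x]scale1r bimod_comm_linear !scale1r. Qed.

Lemma bimod_comm0 H (xi : H) : bimod_comm H 0 xi = 0.
Proof. by apply: (addIr (bimod_comm H 0 xi)); rewrite -bimod_commD !add0r. Qed.

Lemma bimod_commZ H c x (xi : H) :
  bimod_comm H (c *: x) xi = c *: bimod_comm H x xi.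
Proof. by rewrite -[c *: x]addr0 bimod_comm_linear bimod_comm0 addr0. Qed.

(** Vectors are not normalised and [Q'] may be empty, so that the notion starts from the empty set
    and passes to unions, sums and multiples. *)
Definition unitary_controlled (Q : set A) :=
  forall beta : R, 0 < beta ->
  exists (Q' : set A) (beta' : R),
    [/\ finite_set Q', Q' `<=` unitary_group A, 0 < beta'
      & forall H (xi : H),
          (forall u, Q' u -> `|bimod_comm H u xi| < beta'%:C) ->
          forall x, Q x -> `|bimod_comm H x xi| < beta%:C].

Lemma unitary_controlled1 u : unitary_group A u -> unitary_controlled [set u].
Proof.
move=> Uu beta beta_gt0; exists [set u], beta; split=> //.
by move=> _ ->.
Qed.

Lemma unitary_controlledU (P Q : set A) :
  unitary_controlled P -> unitary_controlled Q -> unitary_controlled (P `|` Q).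
Proof.
move=> cP cQ beta beta_gt0.
have [P' [bP [finP UP bP_gt0 hP]]] := cP beta beta_gt0.
have [Q' [bQ [finQ UQ bQ_gt0 hQ]]] := cQ beta beta_gt0.
exists (P' `|` Q'), (Order.min bP bQ); split.
- by rewrite finite_setU.
- by move=> x [/UP|/UQ].
- by rewrite lt_min bP_gt0.
move=> H xi h x [Px|Qx].
- apply: (hP H xi) => // u P'u; apply: lt_le_trans (h u _) _; first by left.
  by rewrite lecR ge_min lexx.
- apply: (hQ H xi) => // u Q'u; apply: lt_le_trans (h u _) _; first by right.
  by rewrite lecR ge_min lexx orbT.
Qed.

Lemma unitary_controlledD x y : unitary_controlled [set x] ->
  unitary_controlled [set y] -> unitary_controlled [set x + y].
Proof.
move=> cx cy beta beta_gt0.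
have beta2_gt0 : 0 < beta / 2 by rewrite divr_gt0.
have [Q' [b [fin U b_gt0 h]]] := unitary_controlledU _ _ cx cy _ beta2_gt0.
exists Q', b; split=> // H xi /h hxi _ ->.
rewrite bimod_commD (splitr beta) rmorphD /=.
apply: le_lt_trans (ler_normD _ _) _.
by apply: ltrD; apply: hxi; [left|right].
Qed.

Lemma unitary_controlledZ (c : R[i]) x :
  unitary_controlled [set x] -> unitary_controlled [set c *: x].
Proof.
move=> cx beta beta_gt0.
have cE : `|c| = (complex.Re `|c|)%:C by rewrite RRe_real // normr_real.
have c_ge0 : 0 <= complex.Re `|c| by rewrite -lecR -cE normr_ge0.
have c1_gt0 : 0 < complex.Re `|c| + 1 by rewrite ltr_wpDl.
(* Dividing by [|c| + 1] instead of [|c|] keeps the tolerance meaningful when [c] is 0. *)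
have [Q' [b [fin U b_gt0 h]]] := cx _ (divr_gt0 beta_gt0 c1_gt0).
exists Q', b; split=> // H xi /h /(_ x erefl) hxi _ ->.
rewrite bimod_commZ normrZ cE.
have [->|c_neq0] := eqVneq (complex.Re `|c|) 0; first by rewrite mul0r ltcR.
have c_gt0 : 0 < complex.Re `|c| by rewrite lt_def c_neq0.
apply: (@lt_trans _ _ ((complex.Re `|c|)%:C * (beta / (complex.Re `|c| + 1))%:C)).
  by rewrite ltr_pM2l // ltcR.
rewrite -rmorphM ltcR mulrCA gtr_pMr // ltr_pdivrMr // mul1r.
by rewrite ltrDl.
Qed.

Lemma unitary_controlled_selfadjoint h : star h = h -> unitary_controlled [set h].
Proof.
(* Division by [r] brings [h] into the ball of radius 1/2; the added 1 keeps [r] positive when [h]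
   is 0. *)
move=> h_sa; pose r : R := 2 * (rnorm R A h + 1).
have n_ge0 := rnorm_ge0 R A h.
have r_gt0 : 0 < r by rewrite mulr_gt0 // ltr_wpDl.
have [u [usu uus] hE] : exists2 u, unitary_group A u &
    r^-1%:C *: h = 2^-1 *: (u + star u).
  apply: selfadjoint_re_unitary.
    by rewrite starZ h_sa; congr (_ *: _); exact: conjc_real.
  rewrite rnormZ ?invr_ge0 ?(ltW r_gt0) // ler_pdivrMl // /r; lra.
have -> : h = (r%:C * 2^-1) *: (u + star u).
  by rewrite -scalerA -hE scalerA -rmorphM mulfV ?gt_eqF // scale1r.
apply: unitary_controlledZ; apply: unitary_controlledD.
  exact: unitary_controlled1.
by apply: unitary_controlled1; rewrite /unitary_group /= starK.
Qed.

Lemma unitary_controlled_all x : unitary_controlled [set x].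
Proof.
have sa_re : star (x + star x) = x + star x by rewrite starD starK addrC.
have sa_im : star ('i%R *: (x - star x)) = 'i%R *: (x - star x).
  by rewrite starZ conjCi starB starK scaleNr -scalerN opprB.
(* Cartesian decomposition; the second summand equals half of [x - star x]. *)
have -> : x = 2^-1 *: (x + star x) + (- (2^-1 * 'i%R)) *: ('i%R *: (x - star x)).
  rewrite scalerA mulNr -mulrA -expr2 sqrCi mulrN1 opprK -scalerDr.
  by rewrite addrACA subrr addr0 scalerDr -scalerDl -[2^-1]mul1r -splitr scale1r.
by apply: unitary_controlledD; apply: unitary_controlledZ;
   exact: unitary_controlled_selfadjoint.
Qed.

Lemma unitary_controlled_finite (Q : set A) :
  finite_set Q -> unitary_controlled Q.
Proof.
move=> /finite_seqP[s ->]; elim: s => [|x s IHs].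
  by move=> beta beta_gt0; exists set0, 1; split=> // H xi _ x.
have -> : [set` x :: s] = [set x] `|` [set` s].
  by apply/seteqP; split=> y /=; rewrite in_cons => /predU1P.
by apply: unitary_controlledU => //; exact: unitary_controlled_all.
Qed.

Lemma almost_central_unitary (Q : set A) (beta : R) :
  finite_set Q -> 0 < beta ->
  exists (Q' : set A) (beta' : R),
    [/\ finite_set Q', Q' !=set0, Q' `<=` unitary_group A, 0 < beta'
      & forall H, almost_central H Q' beta' `<=` almost_central H Q beta].
Proof.
move=> finQ beta_gt0.
have [Q' [b [finQ' UQ' b_gt0 h]]] := unitary_controlled_finite _ finQ _ beta_gt0.
(* Adjoining the unitary 1 makes the test set non-empty. *)
exists (1 |` Q'), b; split=> //.
- by rewrite finite_setU.
- by exists 1; left.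
- by move=> _ [->|/UQ'//]; rewrite /unitary_group /= star1 mulr1.
move=> H xi [xi1 hxi]; split=> // x Qx.
by apply: (h H xi) => // u Q'u; apply: hxi; right.
Qed.

End UnitaryControl.

Theorem lemma2p2 (R : realType) (A : cstarAlgType R) :
  (forall (Q : set A) (beta : R),
     finite_set Q -> Q !=set0 -> 0 < beta ->
     exists (Q' : set A) (beta' : R),
       [/\ finite_set Q', Q' !=set0, Q' `<=` unitary_group A, 0 < beta'
         & forall H : hilbertBimodule A,
             almost_central H Q' beta' `<=` almost_central H Q beta]) /\
  (forall B : set A, unital_cstar_subalgebra B ->
     (property_T B <-> property_T_within (unitary_group A) B) /\
     (strong_property_T B <->
        strong_property_T_within (unitary_group A) B)).
Proof.
split=> [Q beta finQ _|B _]; first exact: almost_central_unitary.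
split; split.
(* Almost central vectors occur only as a hypothesis in both properties, so passing to the smaller
   set given by unitaries preserves the conclusion. Conversely, a set of unitaries is already a
   subset of [A]. *)
- move=> [F [eps [finF _ _ eps_gt0 hF]]].
  have [Q' [b [finQ' Q'0 UQ' b_gt0 sub]]] := almost_central_unitary _ _ _ _ finF eps_gt0.
  exists Q', b; split=> // H [xi /sub Vxi].
  by apply: hF; exists xi.
- by move=> [F [eps [finF F0 _ eps_gt0 hF]]]; exists F, eps; split.
- move=> sT alpha /sT[Q [beta [finQ _ _ beta_gt0 hQ]]].
  have [Q' [b [finQ' Q'0 UQ' b_gt0 sub]]] := almost_central_unitary _ _ _ _ finQ beta_gt0.
  exists Q', b; split=> // H xi /sub; exact: hQ.
- by move=> sT alpha /sT[Q [beta [finQ Q0 _ beta_gt0 hQ]]]; exists Q, beta; split.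
Qed.
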